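(* For every integer $n\ge0$, the odd-indexed even-odd $q$-Lommel polynomials are given by $$p_{2n+1}(x;c,q)=(-c)^n\frac{q^{n^2+\binom{n+1}2}}{(cq;q)_{2n}}\sum_{k=0}^n\frac{(q^{-n},cq^{n+1},cq;q)_k}{(q;q)_k}\,c^{-k}q^{-k^2}x^{2k+1}\sum_{s=0}^{n-k}\frac{(cq^k;q)_s}{(q;q)_s}\,\frac{1-cq^{k+2s}}{1-cq^k}\,\frac{(cq^{n+k+1},q^{k-n},q^{k+1};q)_s}{(q^{-n},cq^{n+1},c;q)_s}\,c^{-s}q^{-(3k+2)s-s(s-1)}.$$
   Context: $c,q$ are indeterminates. $(a;q)_n=\prod_{i=0}^{n-1}(1-aq^i)$ and $(a_1,\dots,a_r;q)_n=\prod_j(a_j;q)_n$. The even-odd $q$-Lommel polynomials are defined by $p_{-1}(x;c,q)=0$, $p_0(x;c,q)=1$, $p_{n+1}(x;c,q)=x\,p_n(x;c,q)-\lambda_np_{n-1}(x;c,q)$ for $n\ge0$, where $\lambda_{2n}=\dfrac{cq^{3n-1}}{(1-cq^{2n-1})(1-cq^{2n})}$ and $\lambda_{2n+1}=\dfrac{q^n}{(1-cq^{2n})(1-cq^{2n+1})}$. *)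

(* Defs.v *)
From mathcomp Require Import all_boot all_order all_algebra.
Set Implicit Arguments.
Unset Strict Implicit.
Unset Printing Implicit Defensive.
Import GRing.Theory.
Local Open Scope ring_scope.

(* The field K(c,q) of rational functions in two indeterminates: c is the
   variable of the inner polynomial ring, q the variable of the outer one. *)
Definition ratfun (K : fieldType) : fieldType := {fraction {poly {poly K}}}.

Definition ratfun_c (K : fieldType) : ratfun K :=
  tofrac (('X : {poly K})%:P : {poly {poly K}}).

Definition ratfun_q (K : fieldType) : ratfun K :=
  tofrac ('X : {poly {poly K}}).

Section EvenOddQLommel.
Variable F : fieldType.
Implicit Types a c q : F.

Definition qpoch q a (n : nat) : F := \prod_(i < n) (1 - a * q ^+ i).

Definition qpochs q (s : seq F) (n : nat) : F := \prod_(a <- s) qpoch q a n.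

Definition lommel_lambda c q (m : nat) : F :=
  let n := m./2 in
  if odd m then
    q ^+ n / ((1 - c * q ^+ (2 * n)) * (1 - c * q ^+ (2 * n + 1)))
  else
    c * q ^ (3 * n%:Z - 1) /
      ((1 - c * q ^ (2 * n%:Z - 1)) * (1 - c * q ^+ (2 * n))).

(* Index shifted by one, so that the sequence can start at p_{-1}:
   [lommel_shift c q m] is p_{m-1}. *)
Fixpoint lommel_shift c q (m : nat) : {poly F} :=
  match m with
  | 0 => 0
  | 1 => 1
  | (n.+1 as n').+1 =>
      'X * lommel_shift c q n' - lommel_lambda c q n *: lommel_shift c q n
  end.

Definition lommel c q (n : nat) : {poly F} := lommel_shift c q n.+1.

End EvenOddQLommel.

(* Main.v *)
Require Import Defs.
From mathcomp Require Import all_boot all_order all_algebra.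
From mathcomp Require Import ring zify.
Import GRing.Theory.
Local Open Scope ring_scope.

(**
The odd-indexed polynomials satisfy a three-term recurrence in n, obtained by
eliminating the even-indexed ones.  Write p_(2n+1) = kappa_n x P_(n+1), where
kappa_n is the prefactor of the formula.  Since
kappa_(n+1) = - lambda_(2n+2) kappa_n, the recurrence becomes a pure difference
equation
  x^2 P_(n+1) = lambda_(2n+1) (P_(n+1) - P_n) - lambda_(2n+2) (P_(n+2) - P_(n+1)),
with P_0 = 0 and P_1 = 1, so it suffices to show that the claimed double sum
satisfies it, coefficient by coefficient.

With N = q^n and a = q^s, every summand of the double sum factors as
weight(k,s) * phi(N,a,k), where
  phi(N,a,k) = (a/N;q)_k (cqNa;q)_k
carries the whole dependence on n and the weight does not involve n
([summand_weight]).  The difference operator L on the right of the recurrence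
lowers the degree k: by [phi_lower], L phi(.,a,k+1) is a combination of
phi(.,a,k) and phi(.,aq,k) whose coefficients are free of N.  Applying L to the
coefficient of x^(2k+2) therefore gives a sum over s in which each phi(N,q^s,k)
occurs twice, and a contiguity relation between the weights
([lowered_weight_S]) merges the two occurrences into weight(k,s): this is the
coefficient of x^(2k).  The last summand, where only the P_(n+2) term is
present, is [phi_boundary].  For the constant term, phi is 1 and the recurrence
compares two consecutive weights.

The computation is valid in any field in which c, q, the 1 - q^(i+1) and the
1 - c q^i are nonzero; these conditions hold for two indeterminates.
*)

Section Generic.
Context (F : fieldType) (c q : F).
Hypothesis c_neq0 : c != 0.
Hypothesis q_neq0 : q != 0.
Hypothesis qX_neq1 : forall i, 1 - q ^+ i.+1 != 0.
Hypothesis cqX_neq1 : forall i, 1 - c * q ^+ i != 0.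

(** * The q-shifted factorial *)

Lemma qpoch0 a : qpoch q a 0 = 1.
Proof. by rewrite /qpoch big_ord0. Qed.

Lemma qpochSr a k : qpoch q a k.+1 = qpoch q a k * (1 - a * q ^+ k).
Proof. by rewrite /qpoch big_ord_recr. Qed.

Lemma qpochD a k s : qpoch q a (k + s) = qpoch q a k * qpoch q (a * q ^+ k) s.
Proof.
elim: s => [|s IH]; first by rewrite addn0 qpoch0 mulr1.
by rewrite addnS !qpochSr IH -!mulrA -exprD.
Qed.

Lemma qpochSl a k : qpoch q a k.+1 = (1 - a) * qpoch q (a * q) k.
Proof. by rewrite -add1n qpochD qpochSr qpoch0 expr0 expr1 mul1r mulr1. Qed.

(** * The n-dependent factor and its difference equation *)

Definition phi N a k : F := qpoch q (a / N) k * qpoch q (c * q * N * a) k.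

Lemma phi_backward_diff (N a : F) k : N != 0 ->
  phi N a k.+1 - phi (N / q) a k.+1 =
  - (a * (1 - q ^+ k.+1) * (1 - c * N ^+ 2) / N)
    * (qpoch q (a * q / N) k * qpoch q (c * q * N * a) k).
Proof.
move=> N0; rewrite /phi (qpochSl (a / N)) (qpochSr (c * q * N * a)).
have -> : a / (N / q) = a * q / N by field; rewrite N0.
have -> : c * q * (N / q) * a = c * N * a by field.
rewrite (qpochSr (a * q / N)) (qpochSl (c * N * a)).
have -> : a / N * q = a * q / N by field.
have -> : c * N * a * q = c * q * N * a by ring.
rewrite exprS; field.
by [].
Qed.

Lemma phi_forward_diff (N a : F) k : N != 0 ->
  phi (q * N) a k.+1 - phi N a k.+1 =
  - (a * (1 - q ^+ k.+1) * (1 - c * (q * N) ^+ 2) / (q * N))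
    * (qpoch q (a / N) k * qpoch q (c * q ^+ 2 * N * a) k).
Proof.
move=> N0; have qN0 : q * N != 0 by rewrite mulf_neq0.
have := phi_backward_diff (q * N) a k qN0.
have -> : q * N / q = N by field.
have -> : a * q / (q * N) = a / N by field; rewrite N0.
by have -> : c * q * (q * N) * a = c * q ^+ 2 * N * a by ring.
Qed.

(** For k > 0 every product here contains (aq/N)_(k-1) (cq^2Na)_(k-1).  Once this
and 1 - cqN^2 are divided out, the left side is linear in 1/N + cqN, hence a
combination of the two linear factors left from phi(N,aq,k) and phi(N,a,k). *)
Lemma phi_contiguous (N a : F) k : N != 0 -> 1 - c * a ^+ 2 * q ^+ k.+1 != 0 ->
  qpoch q (a * q / N) k * qpoch q (c * q * N * a) k
  - c * q * N ^+ 2 * (qpoch q (a / N) k * qpoch q (c * q ^+ 2 * N * a) k) =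
  (1 - c * q * N ^+ 2) / (1 - c * a ^+ 2 * q ^+ k.+1)
    * (phi N (a * q) k - c * a ^+ 2 * q ^+ (2 * k).+1 * phi N a k).
Proof.
move=> N0; case: k => [|k] d0.
  by rewrite /phi !qpoch0; field; move: d0; rewrite expr1.
rewrite /phi.
have -> : c * q * N * (a * q) = c * q ^+ 2 * N * a by ring.
rewrite (qpochSr (a * q / N)) (qpochSl (a / N)).
rewrite (qpochSl (c * q * N * a)) (qpochSr (c * q ^+ 2 * N * a)).
have -> : a / N * q = a * q / N by field.
have -> : c * q * N * a * q = c * q ^+ 2 * N * a by ring.
have -> : q ^+ (2 * k.+1).+1 = q ^+ 3 * q ^+ k ^+ 2.
  by rewrite -exprM -exprD; congr (q ^+ _); lia.
move: d0; rewrite [q ^+ k.+2]exprS [q ^+ k.+1]exprS => d0; field.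
by rewrite N0.
Qed.

(** The recurrence coefficients of indices 2n+1 and 2n+2 at N = q^n. *)
Definition lam_odd N := N / ((1 - c * N ^+ 2) * (1 - c * q * N ^+ 2)).
Definition lam_even N :=
  c * q ^+ 2 * N ^+ 3 / ((1 - c * q * N ^+ 2) * (1 - c * (q * N) ^+ 2)).

(** The reason for the formula: the difference operator of the recurrence lowers
the degree of phi by one, with coefficients that do not involve N. *)
Lemma phi_lower (N a : F) k : N != 0 ->
  1 - c * N ^+ 2 != 0 -> 1 - c * q * N ^+ 2 != 0 ->
  1 - c * (q * N) ^+ 2 != 0 -> 1 - c * a ^+ 2 * q ^+ k.+1 != 0 ->
  lam_odd N * (phi N a k.+1 - phi (N / q) a k.+1)
  - lam_even N * (phi (q * N) a k.+1 - phi N a k.+1) =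
  a * (1 - q ^+ k.+1) / (1 - c * a ^+ 2 * q ^+ k.+1)
    * (c * a ^+ 2 * q ^+ (2 * k).+1 * phi N a k - phi N (a * q) k).
Proof.
move=> N0 d0 d1 d2 d3.
rewrite phi_backward_diff // phi_forward_diff //.
have := phi_contiguous N a k N0 d3.
set U := qpoch _ _ _ * _; set V := qpoch _ _ _ * _.
set Y := phi _ _ _ - _ => E.
have -> : c * a ^+ 2 * q ^+ (2 * k).+1 * phi N a k - phi N (a * q) k = - Y.
  by rewrite /Y opprB.
have -> : U = c * q * N ^+ 2 * V
    + (1 - c * q * N ^+ 2) / (1 - c * a ^+ 2 * q ^+ k.+1) * Y by rewrite -E; ring.
rewrite /lam_odd /lam_even; field.
by rewrite N0 q_neq0 d0 d1 d2 d3.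
Qed.

(** * The weights and their resummation *)

Definition weight k s : F :=
  qpoch q q (k + s) * qpoch q c (k + s) * (1 - c * q ^+ (k + 2 * s))
  / (qpoch q q k ^+ 2 * qpoch q q s * qpoch q c s * (1 - c)
     * c ^+ (k + s) * q ^+ ((k + s) ^ 2 + s * k + s)).

(** The weight multiplied by the factor that [phi_lower] produces at
a = q^s. *)
Definition lowered_weight k s : F :=
  weight k.+1 s * (q ^+ s * (1 - q ^+ k.+1) / (1 - c * q ^+ s ^+ 2 * q ^+ k.+1)).

Lemma qpochq_neq0 k : qpoch q q k != 0.
Proof. by apply/prodf_neq0 => i _; rewrite -exprS. Qed.

Lemma qpochc_neq0 k : qpoch q c k != 0.
Proof. by apply/prodf_neq0 => i _. Qed.

Lemma onem_c_neq0 : 1 - c != 0.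
Proof. by have := cqX_neq1 0; rewrite mulr1. Qed.

Lemma lowered_weightE k s : lowered_weight k s =
  qpoch q q (k + s).+1 * qpoch q c (k + s).+1
  / (qpoch q q k ^+ 2 * (1 - q ^+ k.+1) * qpoch q q s * qpoch q c s * (1 - c)
     * c ^+ (k + s).+1 * q ^+ ((k + s).+1 ^ 2 + s * k.+1)).
Proof.
have E : q ^+ (k.+1 + 2 * s) = q ^+ s ^+ 2 * q ^+ k.+1.
  by rewrite -exprM -exprD; congr (q ^+ _); lia.
have := cqX_neq1 (k.+1 + 2 * s).
rewrite /lowered_weight /weight E mulrA !(addSn k s) (qpochSr q k).
rewrite -exprS (exprD q _ s) => d0.
field.
by rewrite !expf_neq0 ?qpochq_neq0 ?qpochc_neq0 ?onem_c_neq0 ?qX_neq1 ?d0.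
Qed.

Lemma lowered_weight_0 k : c * q ^+ (2 * k).+1 * lowered_weight k 0 = weight k 0.
Proof.
rewrite lowered_weightE /weight !muln0 !mul0n !addn0 !(qpochSr _ k) !qpoch0 -exprS.
have -> : q ^+ (k.+1 ^ 2) = q ^+ (2 * k).+1 * q ^+ (k ^ 2).
  by rewrite -exprD; congr (q ^+ _); lia.
rewrite [c ^+ _]exprS; field.
by rewrite !expf_neq0 ?qpochq_neq0 ?onem_c_neq0 ?qX_neq1 ?c_neq0.
Qed.

(** After removal of common factors, with j = k+s+2 and t = s+1, this is
(1 - q^j)(1 - c q^(j-1)) - q^(k+1) (1 - q^t)(1 - c q^(t-1))
= (1 - q^(k+1))(1 - c q^(j+t-1)). *)
Lemma lowered_weight_S k s :
  c * q ^+ s.+1 ^+ 2 * q ^+ (2 * k).+1 * lowered_weight k s.+1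
  - lowered_weight k s = weight k s.+1.
Proof.
rewrite !lowered_weightE /weight !(addnS k s).
rewrite !(qpochSr _ (k + s).+1) !(qpochSr _ s) -!exprS.
have -> : q ^+ ((k + s).+2 ^ 2 + s.+1 * k.+1)
   = q ^+ (2 * k).+1 * (q ^+ s.+1 ^+ 2 * q ^+ ((k + s).+1 ^ 2 + s.+1 * k + s.+1)).
  by rewrite -!exprM -!exprD; congr (q ^+ _); nia.
have -> : q ^+ ((k + s).+1 ^ 2 + s.+1 * k + s.+1)
   = q ^+ k.+1 * q ^+ ((k + s).+1 ^ 2 + s * k.+1).
  by rewrite -!exprD; congr (q ^+ _); nia.
have -> : q ^+ (k + s).+2 = q ^+ 2 * q ^+ k * q ^+ s.
  by rewrite -!exprD; congr (q ^+ _); lia.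
have -> : q ^+ (k + s).+1 = q * q ^+ k * q ^+ s.
  by rewrite -exprS -exprD.
have -> : q ^+ (k + 2 * s.+1) = q ^+ 2 * q ^+ k * q ^+ s ^+ 2.
  by rewrite -exprM -!exprD; congr (q ^+ _); lia.
have -> : q ^+ s.+1 = q * q ^+ s by rewrite exprS.
have := qX_neq1 k; have := qX_neq1 s.
rewrite [c ^+ (k+s).+2]exprS (exprS q k) (exprS q s) => d1 d2.
field.
rewrite !expf_neq0 ?qpochq_neq0 ?qpochc_neq0 ?onem_c_neq0 ?c_neq0 //.
by rewrite q_neq0 d1 d2 cqX_neq1.
Qed.

(** Regrouping by phi(N,q^s,k): the terms s and s-1 of the sum on the left both
contribute to it, and the second summand is the missing half at s = M. *)
Lemma weight_resum N k M :
  \sum_(s < M) lowered_weight k s *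
    (c * q ^+ s ^+ 2 * q ^+ (2 * k).+1 * phi N (q ^+ s) k
     - phi N (q ^+ s.+1) k)
  + c * q ^+ M ^+ 2 * q ^+ (2 * k).+1 * lowered_weight k M * phi N (q ^+ M) k
  = \sum_(s < M.+1) weight k s * phi N (q ^+ s) k.
Proof.
elim: M => [|M IH].
  by rewrite big_ord0 big_ord_recl big_ord0 addr0 add0r -lowered_weight_0 expr1n mulr1.
rewrite big_ord_recr [in RHS]big_ord_recr /= -IH -lowered_weight_S; ring.
Qed.

(** * The recurrence for the coefficients *)

(** The coefficient of x^(2k) in P_m.  The index is shifted (m = n+1, whence
the division by q) so that m = 0 gives the empty sum needed to start the
recurrence. *)
Definition lommel_coef m k : F :=
  \sum_(s < m - k) weight k s * phi (q ^+ m / q) (q ^+ s) k.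

Lemma phi_eq0 N a i k : (i < k)%N -> a * q ^+ i = N -> N != 0 -> phi N a k = 0.
Proof.
move=> ik aN N0; rewrite /phi /qpoch (bigD1 (Ordinal ik)) //=.
have -> : a / N * q ^+ i = 1 by rewrite mulrAC aN divff.
by rewrite subrr !mul0r.
Qed.

(** The case of [phi_lower] in which q^k a = N.  There phi(N,a,k+1) vanishes, and
the contributions of phi(N/q,a,k+1) and phi(N,aq,k) are absent: both sums have
already stopped. *)
Lemma phi_boundary (N a : F) k : N != 0 -> a * q ^+ k = N ->
  1 - c * q * N ^+ 2 != 0 -> 1 - c * (q * N) ^+ 2 != 0 ->
  1 - c * a ^+ 2 * q ^+ k.+1 != 0 ->
  - (lam_even N * phi (q * N) a k.+1) =
  a * (1 - q ^+ k.+1) / (1 - c * a ^+ 2 * q ^+ k.+1)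
    * (c * a ^+ 2 * q ^+ (2 * k).+1 * phi N a k).
Proof.
move=> N0 aN d1 d2 d3.
have := phi_forward_diff N a k N0.
rewrite (phi_eq0 N a k k.+1) // subr0 => ->.
have E : qpoch q (c * q * N * a) k * (1 - c * q * N ^+ 2)
   = (1 - c * q * N * a) * qpoch q (c * q ^+ 2 * N * a) k.
  have := qpochSl (c * q * N * a) k; rewrite qpochSr.
  have -> : c * q * N * a * q ^+ k = c * q * N ^+ 2.
    by rewrite -[in RHS]aN -[X in c * q * X]aN; ring.
  by have -> : c * q * N * a * q = c * q ^+ 2 * N * a by ring.
have E' : c * a ^+ 2 * q ^+ k.+1 = c * q * N * a by rewrite -aN (exprS q); ring.
have E'' : c * a ^+ 2 * q ^+ (2 * k).+1 = c * q * N ^+ 2.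
  by rewrite -aN (exprS q) mulnC exprM; ring.
rewrite E' in d3 *; rewrite E'' /phi.
have -> : qpoch q (c * q * N * a) k =
  (1 - c * q * N * a) / (1 - c * q * N ^+ 2) * qpoch q (c * q ^+ 2 * N * a) k.
  by rewrite [RHS]mulrAC -E mulfK.
rewrite /lam_even; field.
by rewrite N0 q_neq0 d1 d2 d3.
Qed.

(** All three sums on the right may be taken up to s = n-k-1, where [phi_lower]
applies termwise; the sum for P_(n+2) has one more term, s = n-k, which supplies
exactly the missing half in [weight_resum]. *)
Lemma lommel_coef_rec n k :
  (k <= n)%N ->
  lommel_coef n.+1 k = lam_odd (q ^+ n) * (lommel_coef n.+1 k.+1 - lommel_coef n k.+1)
   - lam_even (q ^+ n) * (lommel_coef n.+2 k.+1 - lommel_coef n.+1 k.+1).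
Proof.
move=> kn.
have qn0 i : q ^+ i != 0 by rewrite expf_neq0.
have d0 : 1 - c * q ^+ n ^+ 2 != 0 by rewrite -exprM.
have d1 : 1 - c * q * q ^+ n ^+ 2 != 0 by rewrite -mulrA -exprM -exprS.
have d2 : 1 - c * (q * q ^+ n) ^+ 2 != 0 by rewrite -exprS -exprM.
have d3 s : 1 - c * q ^+ s ^+ 2 * q ^+ k.+1 != 0 by rewrite -mulrA -exprM -exprD.
have N1 : q ^+ n.+1 / q = q ^+ n by rewrite exprS mulrC mulKf.
have N2 : q ^+ n.+2 / q = q * q ^+ n by rewrite exprS mulrC mulKf // exprS.
rewrite /lommel_coef N1 N2 !subSS (subSn kn).
(* The sum for P_n may be extended to s = n-k-1, where phi vanishes. *)
have -> : \sum_(s < n - k.+1) weight k.+1 s * phi (q ^+ n / q) (q ^+ s) k.+1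
   = \sum_(s < n - k) weight k.+1 s * phi (q ^+ n / q) (q ^+ s) k.+1.
  rewrite subnS; case E : (n - k)%N => [|M] //=.
  rewrite big_ord_recr /= (phi_eq0 _ _ k) ?mulr0 ?addr0 ?mulf_neq0 ?invr_neq0 //.
  by rewrite -exprD (_ : n = (M + k).+1) ?exprS ?[q * _]mulrC ?mulfK //; lia.
set M := (n - k)%N.
rewrite -weight_resum big_ord_recr /=.
set S2 := \sum_(s < M) _ * phi (q * _) _ _.
set S1 := \sum_(s < M) _ * phi (q ^+ n) _ _.
set S0 := \sum_(s < M) _ * phi (q ^+ n / q) _ _.
rewrite (_ : _ - _ = lam_odd (q ^+ n) * (S1 - S0) - lam_even (q ^+ n) * (S2 - S1)
   + weight k.+1 M * - (lam_even (q ^+ n) * phi (q * q ^+ n) (q ^+ M) k.+1)); last by ring.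
rewrite phi_boundary //; last by rewrite -exprD subnK.
congr (_ + _); last by rewrite /lowered_weight; ring.
rewrite /S1 /S0 /S2 -!sumrB !mulr_sumr -sumrB; apply: eq_bigr => s _.
rewrite /lowered_weight -mulrA (exprSr q s) -phi_lower //; ring.
Qed.

Lemma lommel_coef_eq0 m k : (m <= k)%N -> lommel_coef m k = 0.
Proof. by rewrite -subn_eq0 /lommel_coef => /eqP ->; rewrite big_ord0. Qed.

Lemma lommel_coef0_diff m : lommel_coef m.+1 0 - lommel_coef m 0 = weight 0 m.
Proof.
have B0 j : lommel_coef j 0 = \sum_(s < j) weight 0 s.
  by rewrite /lommel_coef subn0; apply: eq_bigr => s _; rewrite /phi !qpoch0 !mulr1.
by rewrite !B0 big_ord_recr /= addrAC subrr add0r.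
Qed.

(** For k = 0 the differences of coefficients are single weights, since
phi = 1 and only the length of the sum depends on n. *)
Lemma lommel_coef0_rec n :
  lam_odd (q ^+ n) * (lommel_coef n.+1 0 - lommel_coef n 0)
   = lam_even (q ^+ n) * (lommel_coef n.+2 0 - lommel_coef n.+1 0).
Proof.
rewrite !lommel_coef0_diff.
rewrite /weight !add0n !muln0 !addn0 !qpoch0 !(qpochSr _ n) /lam_odd /lam_even.
have -> : q ^+ (n.+1 ^ 2 + n.+1) = q ^+ 2 * q ^+ n ^+ 2 * q ^+ (n ^ 2 + n).
  by rewrite -exprM -!exprD; congr (q ^+ _); lia.
have -> : q ^+ (2 * n) = q ^+ n ^+ 2 by rewrite mulnC exprM.
have -> : q ^+ (2 * n.+1) = (q * q ^+ n) ^+ 2 by rewrite mulnC exprM (exprS q n).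
have d0 : 1 - c * q ^+ n ^+ 2 != 0 by rewrite -exprM.
have d1 : 1 - c * q * q ^+ n ^+ 2 != 0 by rewrite -mulrA -exprM -exprS.
have d2 : 1 - c * (q * q ^+ n) ^+ 2 != 0 by rewrite -exprS -exprM.
have d3 := qX_neq1 n; rewrite (exprS q n) in d3; rewrite (exprS c n).
field.
rewrite !expf_neq0 ?qpochq_neq0 ?qpochc_neq0 ?onem_c_neq0 //.
by rewrite q_neq0 c_neq0 cqX_neq1 d0 d1 d2 d3.
Qed.

(** * The normalised polynomials *)

Definition normLommel m : {poly F} := \sum_(k < m) lommel_coef m k *: 'X^(2 * k).

Lemma normLommel_widen m M : (m <= M)%N ->
  normLommel m = \sum_(k < M) lommel_coef m k *: 'X^(2 * k).
Proof.
move=> mM; rewrite /normLommel (big_ord_widen M (fun k => lommel_coef m k *: 'X^(2 * k))) //.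
rewrite big_mkcond; apply: eq_bigr => k _.
by case: ltnP => // mk; rewrite lommel_coef_eq0 ?scale0r.
Qed.

Lemma normLommel_rec n :
  'X^2 * normLommel n.+1 = lam_odd (q ^+ n) *: (normLommel n.+1 - normLommel n)
    - lam_even (q ^+ n) *: (normLommel n.+2 - normLommel n.+1).
Proof.
rewrite (normLommel_widen n n.+2) 1?ltnW // {2 3}(normLommel_widen n.+1 n.+2) //.
rewrite /normLommel -!sumrB !scaler_sumr -sumrB mulr_sumr.
under [RHS]eq_bigr => k _ do rewrite -!scalerBl !scalerA -scalerBl.
rewrite [RHS]big_ord_recl lommel_coef0_rec subrr scale0r add0r.
apply: eq_bigr => k _; have kn : (k <= n)%N by rewrite -ltnS.
by rewrite /= (lommel_coef_rec n k kn) -scalerAr -exprD mulnS.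
Qed.

Lemma normLommel_step n :
  - lam_even (q ^+ n) *: normLommel n.+2 =
  ('X^2 - (lam_odd (q ^+ n) + lam_even (q ^+ n))%:P) * normLommel n.+1
  + lam_odd (q ^+ n) *: normLommel n.
Proof.
rewrite mulrBl normLommel_rec -!mul_polyC polyCN polyCD; ring.
Qed.

Lemma normLommel1 : normLommel 1 = 1.
Proof.
rewrite /normLommel big_ord1 muln0 expr0.
have := lommel_coef0_diff 0; rewrite (lommel_coef_eq0 0 0) // subr0 => ->.
rewrite /weight !qpoch0 /=  !expr0 expr1n !mulr1 !mul1r.
by rewrite divff ?onem_c_neq0 // scale1r.
Qed.

(** * Identification with the even-odd polynomials *)

Definition kappa n : F :=
  (- c) ^+ n * (q ^+ (n ^ 2 + 'C(n.+1, 2)) / qpoch q (c * q) (2 * n)).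

Lemma lommel_lambda_odd n : lommel_lambda c q (2 * n).+1 = lam_odd (q ^+ n).
Proof.
rewrite /lommel_lambda /= mul2n odd_double /= uphalf_double /lam_odd.
by rewrite -!exprM -mulrA -exprS addn1 muln2 mul2n.
Qed.

Lemma lommel_lambda_even n : lommel_lambda c q (2 * n).+2 = lam_even (q ^+ n).
Proof.
rewrite /lommel_lambda /= mul2n odd_double /= doubleK /lam_even -exprS.
rewrite (_ : 3 * n.+1%:Z - 1 = (2 + n * 3)%N); last lia.
rewrite (_ : 2 * n.+1%:Z - 1 = (1 + n * 2)%N); last lia.
by rewrite -!exprnP (mulnC 2) !exprD expr1 !exprM !mulrA.
Qed.

(** This ratio is what turns the three-term recurrence into one in which only
differences of consecutive polynomials occur. *)
Lemma kappaS n : kappa n.+1 = - lam_even (q ^+ n) * kappa n.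
Proof.
rewrite /kappa (_ : n.+1 ^ 2 + 'C(n.+2, 2) = n ^ 2 + 'C(n.+1, 2) + (2 + n * 3))%N; last first.
  by rewrite binS bin1; nia.
rewrite (mulnS 2) add2n.
rewrite !qpochSr (exprD q (n ^ 2 + _)) (exprD q 2) (exprM q n) (exprS (- c)) /lam_even.
have -> : c * q * q ^+ (2 * n) = c * q * q ^+ n ^+ 2 by rewrite mulnC exprM.
have -> : c * q * q ^+ (2 * n).+1 = c * (q * q ^+ n) ^+ 2.
  by rewrite (exprS q (2 * n)) mulnC exprM; ring.
have d1 : 1 - c * q * q ^+ n ^+ 2 != 0 by rewrite -mulrA -exprM -exprS.
have d2 : 1 - c * (q * q ^+ n) ^+ 2 != 0 by rewrite -exprS -exprM.
field; rewrite d1 d2 !andbT.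
by apply/prodf_neq0 => i _; rewrite -mulrA -exprS.
Qed.

Lemma lommel_norm n : lommel c q (2 * n + 1) = kappa n *: ('X * normLommel n.+1).
Proof.
rewrite /lommel addn1.
pose L m := lommel_shift c q m.
have LS m : L m.+2 = 'X * L m.+1 - lommel_lambda c q m *: L m by [].
(* Elimination of the even-indexed polynomials. *)
have step m : L (2 * m).+4 = ('X^2 - (lam_odd (q ^+ m) + lam_even (q ^+ m))%:P) * L (2 * m).+2
    - (lam_odd (q ^+ m) * lommel_lambda c q (2 * m)) *: L (2 * m)%N.
  rewrite (LS (2 * m).+2) (LS (2 * m).+1) lommel_lambda_even lommel_lambda_odd.
  have XL : 'X * L (2 * m).+1
      = L (2 * m).+2 + lommel_lambda c q (2 * m) *: L (2 * m)%N.
    by rewrite [in RHS]LS subrK.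
  rewrite [X in 'X * X]addrC mulrDr mulrN -scalerAr XL.
  move: (lam_odd _) (lam_even _) (lommel_lambda _ _ _) => l1 l2 l0.
  by rewrite -!mul_polyC !polyCM !polyCD; ring.
have base : L 2 = 'X.
  by rewrite LS /= mulr1 scaler0 subr0.
suff H m : L (2 * m).+2 = kappa m *: ('X * normLommel m.+1) /\
     L (2 * m).+4 = kappa m.+1 *: ('X * normLommel m.+2) by case: (H n).
have k0 : kappa 0 = 1 by rewrite /kappa !qpoch0 /= !mul1r invr1.
elim: m => [|m [IH1 IH2]]; split.
- by rewrite muln0 base k0 normLommel1 mulr1 scale1r.
- rewrite step !muln0 base scaler0 subr0 kappaS k0 mulr1 scalerAr normLommel_step.
  by rewrite normLommel1 /normLommel big_ord0 scaler0 addr0 mulr1 mulrC.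
- by rewrite mulnS.
rewrite step mulnS !add2n lommel_lambda_even IH1 IH2 (kappaS m.+1).
rewrite [X in _ = X *: _]mulrC -[RHS]scalerA [in RHS]scalerAr normLommel_step.
rewrite (kappaS m); move: (lam_odd _) (lam_even (q ^+ m)) (lam_even _) (kappa m) => l1 l2 l2' k.
by rewrite -!mul_polyC !polyCM !polyCN; ring.
Qed.

(** * The summand of the stated formula *)

Lemma qpochqVn_neq0 n k : (k <= n)%N -> qpoch q (q ^+ n)^-1 k != 0.
Proof.
move=> kn; apply/prodf_neq0 => -[i /= ik] _.
have -> : (q ^+ n)^-1 * q ^+ i = (q ^+ (n - i).-1.+1)^-1.
  have {1}-> : n = (n - i + i)%N by lia.
  by rewrite exprD invfM mulfVK ?expf_neq0 //; congr (_ ^+ _)^-1; lia.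
rewrite -(mulfV (expf_neq0 (n - i).-1.+1 q_neq0)) -[X in _ - X]mul1r -mulrBl.
by rewrite mulf_neq0 ?invr_neq0 ?expf_neq0 // -opprB oppr_eq0.
Qed.

Lemma qpoch_cqX_neq0 n k : qpoch q (c * q ^+ n) k != 0.
Proof. by apply/prodf_neq0 => i _; rewrite -mulrA -exprD. Qed.

(** Used to trade (q^(k-n))_s / (q^(-n))_s for (q^(s-n))_k / (q^(-n))_k. *)
Lemma qpoch_exchange a k s :
  qpoch q a k * qpoch q (a * q ^+ k) s = qpoch q a s * qpoch q (a * q ^+ s) k.
Proof. by rewrite -!qpochD addnC. Qed.

(** Reading (q^(-n))_k (q^(k-n))_s as (q^(-n))_(k+s), and likewise for
c q^(n+1), isolates the n-dependence into phi. *)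
Lemma summand_weight n k s : (k <= n)%N -> (s <= n)%N ->
  qpochs q [:: q ^ (- n%:Z); c * q ^+ (n + 1); c * q] k / qpoch q q k
    * c ^ (- k%:Z) * q ^ (- (k%:Z ^+ 2))
  * (qpoch q (c * q ^+ k) s / qpoch q q s
     * ((1 - c * q ^+ (k + 2 * s)) / (1 - c * q ^+ k))
     * (qpochs q [:: c * q ^+ (n + k + 1); q ^ (k%:Z - n%:Z); q ^+ (k + 1)] s
        / qpochs q [:: q ^ (- n%:Z); c * q ^+ (n + 1); c] s)
     * c ^ (- s%:Z) * q ^ (- ((3 * k%:Z + 2) * s%:Z) - s%:Z * (s%:Z - 1)))
  = weight k s * phi (q ^+ n) (q ^+ s) k.
Proof.
move=> kn sn; rewrite /qpochs !big_cons !big_nil !mulr1.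
have -> : q ^ (- n%:Z) = (q ^+ n)^-1 by rewrite -invr_expz.
have -> : c ^ (- k%:Z) = (c ^+ k)^-1 by rewrite -invr_expz.
have -> : c ^ (- s%:Z) = (c ^+ s)^-1 by rewrite -invr_expz.
have -> : q ^ (k%:Z - n%:Z) = (q ^+ n)^-1 * q ^+ k.
  by rewrite expfzDr // mulrC -invr_expz.
have Eq : q ^ (- (k%:Z ^+ 2)) * q ^ (- ((3 * k%:Z + 2) * s%:Z) - s%:Z * (s%:Z - 1))
    = (q ^+ ((k + s) ^ 2 + s * k + s))^-1.
  rewrite -expfzDr //.
  have -> : (q ^+ ((k + s) ^ 2 + s * k + s))^-1 = q ^ (- ((k + s) ^ 2 + s * k + s)%:Z).
    by rewrite -invr_expz.
  by congr (q ^ _); rewrite -mulnn !PoszD !PoszM !PoszD; ring.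
have F1 : qpoch q ((q ^+ n)^-1 * q ^+ k) s =
    qpoch q (q ^+ n)^-1 s * qpoch q (q ^+ s / q ^+ n) k / qpoch q (q ^+ n)^-1 k.
  by rewrite (mulrC (q ^+ s)) -qpoch_exchange mulrAC divff ?mul1r ?qpochqVn_neq0.
have F2 : qpoch q (c * q ^+ (n + k + 1)) s =
    qpoch q (c * q ^+ (n + 1)) s * qpoch q (c * q * q ^+ n * q ^+ s) k
    / qpoch q (c * q ^+ (n + 1)) k.
  have -> : c * q * q ^+ n * q ^+ s = c * q ^+ (n + 1) * q ^+ s.
    by rewrite addn1 exprS !mulrA.
  rewrite -qpoch_exchange mulrAC divff ?mul1r ?qpoch_cqX_neq0 //.
  by rewrite -mulrA -exprD addnAC.
have F3 : qpoch q q (k + s) = qpoch q q k * qpoch q (q ^+ (k + 1)) s.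
  by rewrite qpochD addn1 exprS.
have ck : 1 - c * q ^+ k != 0 by [].
have F4 : qpoch q (c * q) k = qpoch q c k * (1 - c * q ^+ k) / (1 - c).
  by rewrite -qpochSr qpochSl mulrAC divff ?mul1r ?onem_c_neq0.
rewrite /weight /phi F1 F2 F3 F4 (qpochD c) (exprD c).
have -> : q ^+ ((k + s) ^ 2 + s * k + s) = (q ^ (- (k%:Z ^+ 2)) *
    q ^ (- ((3 * k%:Z + 2) * s%:Z) - s%:Z * (s%:Z - 1)))^-1 by rewrite Eq invrK.
move: (q ^ (- (k%:Z ^+ 2))) (expfz_neq0 (- (k%:Z ^+ 2)) q_neq0) => e1 e1_neq0.
move: (q ^ (- _ - _)) (expfz_neq0 (- ((3 * k%:Z + 2) * s%:Z) - s%:Z * (s%:Z - 1)) q_neq0)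
  => e2 e2_neq0.
field.
rewrite !expf_neq0 ?qpochq_neq0 ?qpochc_neq0 ?qpochqVn_neq0 ?qpoch_cqX_neq0 //.
by rewrite e1_neq0 e2_neq0 ck onem_c_neq0.
Qed.


(** The formula at any generic point of any field. *)
Lemma lommel_formula n :
  lommel c q (2 * n + 1) =
    ((- c) ^+ n * (q ^+ (n ^ 2 + 'C(n.+1, 2)) / qpoch q (c * q) (2 * n))) *:
    \sum_(0 <= k < n.+1)
      (qpochs q [:: q ^ (- n%:Z); c * q ^+ (n + 1); c * q] k / qpoch q q k
         * c ^ (- k%:Z) * q ^ (- (k%:Z ^+ 2))
         * \sum_(0 <= s < (n - k).+1)
             (qpoch q (c * q ^+ k) s / qpoch q q s
              * ((1 - c * q ^+ (k + 2 * s)) / (1 - c * q ^+ k))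
              * (qpochs q [:: c * q ^+ (n + k + 1); q ^ (k%:Z - n%:Z);
                              q ^+ (k + 1)] s
                 / qpochs q [:: q ^ (- n%:Z); c * q ^+ (n + 1); c] s)
              * c ^ (- s%:Z)
              * q ^ (- ((3 * k%:Z + 2) * s%:Z) - s%:Z * (s%:Z - 1))))
      *: 'X^(2 * k + 1).
Proof.
rewrite lommel_norm /kappa /normLommel mulr_sumr; congr (_ *: _).
rewrite big_mkord; apply: eq_bigr => -[k /=]; rewrite ltnS => kn _.
rewrite (addn1 (2 * k)) -scalerAr -exprS /lommel_coef subSn // big_mkord mulr_sumr.
congr (_ *: _).
apply: eq_bigr => s _.
rewrite (exprSr q n) mulfK // summand_weight //.
by have := ltn_ord s; rewrite ltnS => /leq_trans-> //; exact: leq_subr.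
Qed.

End Generic.

(** * Genericity of the indeterminates *)

Lemma ratfun_q_neq0 (K : fieldType) : ratfun_q K != 0.
Proof. by rewrite tofrac_eq0 polyX_eq0. Qed.

Lemma ratfun_c_neq0 (K : fieldType) : ratfun_c K != 0.
Proof. by rewrite tofrac_eq0 polyC_eq0 polyX_eq0. Qed.

Lemma ratfun_qX_neq1 (K : fieldType) i : 1 - ratfun_q K ^+ i.+1 != 0.
Proof.
rewrite -tofracXn -tofrac1 -tofracB tofrac_eq0 subr_eq0.
apply/eqP => /(congr1 (fun p : {poly {poly K}} => p`_0)).
by rewrite coefXn coef1 /= => /eqP; rewrite oner_eq0.
Qed.

Lemma ratfun_cqX_neq1 (K : fieldType) i : 1 - ratfun_c K * ratfun_q K ^+ i != 0.
Proof.
rewrite -tofracXn -tofracM -tofrac1 -tofracB tofrac_eq0 subr_eq0.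
apply/eqP => /(congr1 (fun p : {poly {poly K}} => p`_i`_1)).
rewrite coef1 coefCM coefXn eqxx mulr1 coefX -polyC_natr coefC /= => /eqP.
by rewrite eq_sym oner_eq0.
Qed.

Theorem theorem4p2 (K : fieldType) (n : nat) :
  let c : ratfun K := ratfun_c K in
  let q : ratfun K := ratfun_q K in
  lommel c q (2 * n + 1) =
    ((- c) ^+ n * (q ^+ (n ^ 2 + 'C(n.+1, 2)) / qpoch q (c * q) (2 * n))) *:
    \sum_(0 <= k < n.+1)
      (qpochs q [:: q ^ (- n%:Z); c * q ^+ (n + 1); c * q] k / qpoch q q k
         * c ^ (- k%:Z) * q ^ (- (k%:Z ^+ 2))
         * \sum_(0 <= s < (n - k).+1)
             (qpoch q (c * q ^+ k) s / qpoch q q s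
              * ((1 - c * q ^+ (k + 2 * s)) / (1 - c * q ^+ k))
              * (qpochs q [:: c * q ^+ (n + k + 1); q ^ (k%:Z - n%:Z);
                              q ^+ (k + 1)] s
                 / qpochs q [:: q ^ (- n%:Z); c * q ^+ (n + 1); c] s)
              * c ^ (- s%:Z)
              * q ^ (- ((3 * k%:Z + 2) * s%:Z) - s%:Z * (s%:Z - 1))))
      *: 'X^(2 * k + 1).
Proof.
move=> c q; apply: lommel_formula.
- exact: ratfun_c_neq0.
- exact: ratfun_q_neq0.
- exact: ratfun_qX_neq1.
- exact: ratfun_cqX_neq1.
Qed.
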